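(* Let $\alpha\in(0,1)$ and let $\mathcal P_\Theta=\{p_\theta\}_{\theta\in\Theta}$ be a set of probability densities with respect to a common measure $\mu$. Suppose that the data $Y_1,\dots,Y_{2n}$ come i.i.d. from a distribution with density $q\notin\mathcal P_\Theta$. Split the data into two groups $D_0,D_1$ of size $n$, let $\widehat\theta_1\in\Theta$ be any estimator constructed from $D_1$, and let $C_n$ be the universal confidence set $$C_n=\Big\{p\in\mathcal P_\Theta:\ \prod_{i\in D_0}\frac{p_{\widehat\theta_1}(Y_i)}{p(Y_i)}\le\frac1\alpha\Big\}.$$ If $\mathcal P_\Theta$ is convex and there exists a density $p^*\in\mathcal P_\Theta$ such that $K(q,p^* )=\inf_{\theta\in\Theta}K(q,p_\theta)$, then $$P_q(p^*\in C_n)\ge 1-\alpha.$$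
   Context: $K(q,p)=\int q\log(q/p)\,d\mu$ is the Kullback–Leibler divergence. $P_q$ denotes probability when the data are drawn from $q$. The data are split at random into $D_0$ and $D_1$. The universal confidence set is written here as a set of densities, i.e. a parameter $\theta$ is identified with its density $p_\theta$.
   Formalization: The formal theorem additionally assumes that the minimal divergence K(q,p* ) is finite; without this every density is a minimiser when all divergences are infinite and the claim fails (q Cauchy, normal mixtures). *)

(* Defs.v *)
From HB Require Import structures.
From mathcomp Require Import all_boot all_order all_algebra.
From mathcomp Require Import all_classical all_reals all_analysis.

Set Implicit Arguments.
Unset Strict Implicit.
Unset Printing Implicit Defensive.

Import Order.TTheory GRing.Theory Num.Theory.

Local Open Scope classical_set_scope.
Local Open Scope ring_scope.

(* Densities are functions, not classes modulo mu-almost everywhere equality. *)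
Definition is_density (R : realType) (d : measure_display)
    (T : measurableType d) (mu : {measure set T -> \bar R}) (f : T -> R) : Prop :=
  [/\ measurable_fun [set: T] f, forall x, 0 <= f x
    & (\int[mu]_x (f x)%:E = 1)%E].

(* In \bar R one has 0^-1 = +oo, lne 0 = -oo, lne +oo = +oo and 0 * +oo = 0, so
   the integrand is 0 where q = 0 and +oo where p = 0 < q.  Its negative part is
   at most max (p - q) 0, so for densities the integral lies in [0, +oo]. *)
Definition KL (R : realType) (d : measure_display) (T : measurableType d)
    (mu : {measure set T -> \bar R}) (q p : T -> R) : \bar R :=
  (\int[mu]_x ((q x)%:E * lne ((q x)%:E / (p x)%:E)))%E.

(* Taking B i = setT for some indices i gives the product rule for every
   subfamily of Y. *)
Definition mutually_independent (R : realType) (dO dT : measure_display)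
    (Omega : measurableType dO) (T : measurableType dT)
    (P : probability Omega R) (N : nat) (Y : 'I_N -> {RV P >-> T}) : Prop :=
  forall B : 'I_N -> set T, (forall i, measurable (B i)) ->
    P [set w | forall i, B i (Y i w)] = (\prod_(i < N) P (Y i @^-1` B i))%E.

Definition iid_from_density (R : realType) (dO dT : measure_display)
    (Omega : measurableType dO) (T : measurableType dT)
    (mu : {measure set T -> \bar R}) (q : T -> R)
    (P : probability Omega R) (N : nat) (Y : 'I_N -> {RV P >-> T}) : Prop :=
  mutually_independent Y /\
  forall (i : 'I_N) (B : set T), measurable B ->
    distribution P (Y i) B = (\int[mu]_(x in B) (q x)%:E)%E.

Definition data_tuple (R : realType) (dO dT : measure_display)
    (Omega : measurableType dO) (T : measurableType dT)
    (P : probability Omega R) (N : nat) (Y : 'I_N -> {RV P >-> T})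
    (w : Omega) : N.-tuple T := [tuple Y i w | i < N].

(* A split is given by the set of indices of the observations placed in D_0;
   those of D_1 form the complement. *)
Definition data_split (n : nat) : Type := {D0 : {set 'I_(2 * n)} | #|D0| == n}.

Lemma card_D1 (n : nat) (s : data_split n) : #|~: sval s| = n.
Proof.
by rewrite cardsCs finset.setCK (eqP (svalP s)) card_ord mul2n -addnn addnK.
Qed.

(* The observations of D_1, listed by increasing index. *)
Definition D1_data (n : nat) (T : Type) (s : data_split n) (y : (2 * n).-tuple T) :
    n.-tuple T :=
  [tuple tnth y (enum_val (cast_ord (esym (card_D1 s)) j)) | j < n].

(* The law of the split is arbitrary: a uniformly random split and a fixed one
   are both instances. *)
Definition random_split (R : realType) (dO dT : measure_display)
    (Omega : measurableType dO) (T : measurableType dT)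
    (P : probability Omega R) (n : nat) (Y : 'I_(2 * n) -> {RV P >-> T})
    (S : Omega -> data_split n) : Prop :=
  (forall s, measurable (S @^-1` [set s])) /\
  (forall s (B : set ((2 * n).-tuple T)), measurable B ->
    P (S @^-1` [set s] `&` data_tuple Y @^-1` B) =
    (P (S @^-1` [set s]) * P (data_tuple Y @^-1` B))%E).

(* Minimal regularity: the density chosen by the estimator is jointly measurable
   in the sample and the evaluation point.  It holds whenever Theta is a
   measurable space, (theta, x) |-> p theta x is jointly measurable and the
   estimator is measurable. *)
Definition measurable_estimator (R : realType) (d : measure_display)
    (T : measurableType d) (Theta : Type) (p : Theta -> T -> R) (n : nat)
    (hat : n.-tuple T -> Theta) : Prop :=
  measurable_fun [set: n.-tuple T * T] (fun z => p (hat z.1) z.2).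

(* The likelihood ratio is taken in \bar R: a / 0 = +oo for a > 0, and 0 / 0 = 0. *)
Definition universal_set (R : realType) (T Theta : Type) (p : Theta -> T -> R)
    (alpha : R) (n : nat) (hat : n.-tuple T -> Theta)
    (s : data_split n) (y : (2 * n).-tuple T) : set (T -> R) :=
  [set f | range p f /\
    (\prod_(i in sval s)
       ((p (hat (D1_data s y)) (tnth y i))%:E / (f (tnth y i))%:E)
     <= (1 / alpha)%:E)%E].

(* Main.v *)
(* Convexity makes p* a log-likelihood projection with E_q[p_theta / p*] <= 1 for
   every theta: since the mixture m = (1 - t) p* + t p_theta is in the model,
   K(q, p* ) <= K(q, m), and ln x <= x - 1 turns this into E_q[p_theta / m] <= 1;
   letting t tend to 0 monotonically gives the claim.  Given the sample D_1, the
   likelihood ratio over D_0 is then a product of independent factors of mean at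
   most 1, so Markov's inequality bounds the probability that it exceeds
   1 / alpha. *)
Require Import Defs.
From HB Require Import structures.
From mathcomp Require Import all_boot all_order all_algebra.
From mathcomp Require Import all_classical all_reals all_analysis.
From mathcomp Require Import measurable_realfun measurable_fun_approximation.
From mathcomp Require Import simple_functions ring lra.

Set Implicit Arguments.
Unset Strict Implicit.

Import Order.TTheory GRing.Theory Num.Theory.
Import numFieldNormedType.Exports.

Local Open Scope classical_set_scope.
Local Open Scope ring_scope.

(** * Measurability of likelihood ratios and pointwise bounds on the KL integrand *)

Lemma measurable_invr (R : realType) :
  measurable_fun [set: R] (@GRing.inv R).
Proof.
rewrite -(setUv [set 0]); apply/measurable_funU => //.
- exact: measurableC.
- split.
  + exact: measurable_fun_set1.
  + have o : open (~` [set 0 : R]) by apply: closed_openC; exact: closed_eq.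
    apply: open_continuous_measurable_fun => // x.
    by rewrite inE/= => /eqP; exact: inv_continuous.
Qed.

Lemma measurable_ediv (R : realType) (d : measure_display)
    (T : measurableType d) (a b : T -> R) :
  measurable_fun setT a -> measurable_fun setT b ->
  measurable_fun setT (fun x => (a x)%:E / (b x)%:E : \bar R)%E.
Proof.
move=> ma mb; apply: emeasurable_funM; first exact/measurable_EFinP.
under eq_fun do rewrite inver.
apply: measurable_fun_ifT.
- exact: measurable_fun_eqr.
- exact: measurable_cst.
- by apply/measurable_EFinP; apply: measurableT_comp => //; exact: measurable_invr.
Qed.

Lemma kl_integrandE (R : realType) (q p : R) : 0 <= q -> 0 <= p ->
  (q%:E * lne (q%:E / p%:E) =
   if q == 0%R then 0 else if p == 0%R then +oo else (q * ln (q / p))%:E)%E.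
Proof.
move=> q0 p0; have [->|qn] := eqVneq q 0; first by rewrite mul0e.
have qp : 0 < q by rewrite lt_neqAle eq_sym qn.
rewrite inver; have [_|pn] := eqVneq p 0.
  by rewrite gt0_muley ?lte_fin//= gt0_muley ?lte_fin.
have pp : 0 < p by rewrite lt_neqAle eq_sym pn.
by rewrite -EFinM lne_EFin ?divr_gt0.
Qed.

Lemma ln_le_subr1 (R : realType) (x : R) : 0 < x -> ln x <= x - 1.
Proof.
move=> x0; have := @le_ln1Dx R (x - 1).
by rewrite addrCA subrr addr0; apply; lra.
Qed.

(** For positive arguments, [ln (p / q) <= p / q - 1] times [q] gives
    [q * ln (q / p) >= q - p >= - p]. The negative part of the KL integrand is thus dominated by an
    integrable density. *)
Lemma kl_integrand_ge (R : realType) (q p : R) : 0 <= q -> 0 <= p ->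
  (- p%:E <= q%:E * lne (q%:E / p%:E))%E.
Proof.
move=> q0 p0; rewrite kl_integrandE//; have [_|qn] := eqVneq q 0.
  by rewrite -EFinN lee_fin oppr_le0.
have [_|pn] := eqVneq p 0; first by rewrite leey.
have qp : 0 < q by rewrite lt_neqAle eq_sym qn.
have pp : 0 < p by rewrite lt_neqAle eq_sym pn.
rewrite -EFinN lee_fin -[q / p]invrK invf_div lnV ?posrE ?divr_gt0//.
rewrite mulrN lerN2.
apply: (@le_trans _ _ (q * (p / q - 1))).
  by rewrite ler_pM2l// ln_le_subr1// divr_gt0.
by rewrite mulrBr mulr1 mulrC divfK// gerBl.
Qed.

(** This is [q] times [ln (p / m) <= p / m - 1], where the form of [m] gives
    [p / m - 1 = t / (1 - t) * (1 - f / m)]. Every term is added rather than subtracted, so the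
    inequality keeps its meaning when the right-hand side is infinite, as it is for [p = 0 < q]. *)
Lemma kl_integrand_mix (R : realType) (q p f t m : R) :
    0 <= q -> 0 <= p -> 0 <= f -> 0 < t < 1 -> m = (1 - t) * p + t * f ->
  (q%:E * lne (q%:E / m%:E) + (t / (1 - t) * (q * (f / m)))%:E <=
   q%:E * lne (q%:E / p%:E) + (t / (1 - t) * q)%:E)%E.
Proof.
move=> q0 p0 f0 /andP[t0 t1] mE.
have u0 : 0 < 1 - t by lra.
have [q00|qn] := eqVneq q 0; first by rewrite q00 !mul0e !mul0r !mulr0.
have qp : 0 < q by rewrite lt_neqAle eq_sym qn.
have [p00|pn] := eqVneq p 0.
  rewrite p00 [X in (_ <= X + _)%E](_ : _ = +oo)%E ?addye ?leey//.
  by rewrite kl_integrandE// (negbTE qn) eqxx.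
have pp : 0 < p by rewrite lt_neqAle eq_sym pn.
have mp : 0 < m by rewrite mE ltr_pwDl ?mulr_gt0 ?mulr_ge0// ltW.
rewrite !kl_integrandE ?(ltW mp)// (negbTE qn) (negbTE pn) (gt_eqF mp).
rewrite -!EFinD lee_fin.
rewrite !ln_div ?posrE//.
have : ln (p / m) <= p / m - 1 by rewrite ln_le_subr1 ?divr_gt0.
rewrite ln_div ?posrE// => H.
have E : p / m - 1 = t / (1 - t) * (1 - f / m).
  by rewrite mE; field; rewrite -mE; apply/andP; split; apply: lt0r_neq0 => //; lra.
rewrite {}E in H.
have := ler_wpM2l q0 H.
set c := t / (1 - t); set e := f / m; nra.
Qed.

(* The integral of g need not be finite, so additivity of the integral of
   integrable functions does not apply. *)
Lemma ge0_integralD_lower (R : realType) (d : measure_display)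
    (T : measurableType d) (mu : {measure set T -> \bar R})
    (g : T -> \bar R) (h : T -> R) :
    measurable_fun setT g -> measurable_fun setT h -> (forall x, 0 <= h x) ->
    (forall x, - (h x)%:E <= g x)%E -> (\int[mu]_x (h x)%:E < +oo)%E ->
  (\int[mu]_x (g x + (h x)%:E) = \int[mu]_x g x + \int[mu]_x (h x)%:E)%E.
Proof.
move=> mg mh h0 hg hoo.
have mgn := measurable_funeneg mg; have mgp := measurable_funepos mg.
have mhE : measurable_fun setT (fun x => (h x)%:E) by exact/measurable_EFinP.
have gnh x : (g^\- x <= (h x)%:E)%E.
  by rewrite funenegE ge_max lee_fin h0 andbT leeNl.
have gh0 x : (0 <= g x + (h x)%:E)%E.
  by have := leeD2r (h x)%:E (hg x); rewrite -EFinN -EFinD addNr.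
have gnfin : (\int[mu]_x g^\- x)%E \is a fin_num.
  rewrite ge0_fin_numE; last exact: integral_ge0.
  by apply: le_lt_trans hoo; apply: ge0_le_integral.
(* Pointwise [(g + h) + g^- = g^+ + h] with all four terms nonnegative, so additivity is available
   on both sides. The integral of [g^-] is finite and can be subtracted afterwards. *)
have E : (\int[mu]_x (g x + (h x)%:E) + \int[mu]_x g^\- x =
          \int[mu]_x g^\+ x + \int[mu]_x (h x)%:E)%E.
  rewrite -ge0_integralD//; last exact: emeasurable_funD.
  rewrite -ge0_integralD//; last by move=> x _; rewrite lee_fin.
  apply: eq_integral => x _.
  have gnf : (g^\- x)%E \is a fin_num.
    by rewrite ge0_fin_numE//; apply: le_lt_trans (gnh x) _; rewrite ltry.
  have -> : g x = (g^\+ x - g^\- x)%E by rewrite [in LHS](funeposneg g).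
  by rewrite addeAC subeK.
rewrite (integralE mu setT g) -[LHS](addeK _ gnfin) E.
by rewrite addeAC.
Qed.

Lemma measurable_kl_integrand (R : realType) (d : measure_display)
    (T : measurableType d) (q p : T -> R) :
    measurable_fun setT q -> measurable_fun setT p ->
    (forall x, 0 <= q x) -> (forall x, 0 <= p x) ->
  measurable_fun setT (fun x => (q x)%:E * lne ((q x)%:E / (p x)%:E))%E.
Proof.
move=> mq mp q0 p0.
under eq_fun do rewrite kl_integrandE//.
apply: measurable_fun_ifT => //; first exact: measurable_fun_eqr.
apply: measurable_fun_ifT => //; first exact: measurable_fun_eqr.
apply/measurable_EFinP; apply: measurable_funM => //.
apply: measurableT_comp => //; apply: measurable_funM => //.
by apply: measurableT_comp => //; exact: measurable_invr.
Qed.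

(** * First-order condition along a mixture *)

Section first_order_condition.
Context (R : realType) (d : measure_display) (T : measurableType d).
Variables (mu : {measure set T -> \bar R}) (q p f : T -> R).
Hypotheses (hq : is_density mu q) (hp : is_density mu p) (hf : is_density mu f).

(** Adding the density [g] makes the KL integrand nonnegative at the known cost 1, so the comparison
    of divergences can be carried out with nonnegative integrals only. *)
Let KL_shift (g : T -> R) : is_density mu g ->
  (\int[mu]_x ((q x)%:E * lne ((q x)%:E / (g x)%:E) + (g x)%:E) =
   KL mu q g + 1)%E.
Proof.
move: hq => [mq q0 _] [mg g0 g1].
rewrite ge0_integralD_lower ?g1 ?ltry//; first exact: measurable_kl_integrand.
by move=> x; exact: kl_integrand_ge.
Qed.

Lemma mixture_ratio_le1 (t : R) (m : T -> R) : 0 < t < 1 ->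
    (forall x, m x = (1 - t) * p x + t * f x) -> is_density mu m ->
    (KL mu q p < +oo)%E -> (KL mu q p <= KL mu q m)%E ->
  (\int[mu]_x (q x * (f x / m x))%:E <= 1)%E.
Proof.
move=> t01 mE hm KLoo KLle; have /andP[t0 t1] := t01.
have c0 : 0 < t / (1 - t) by rewrite divr_gt0//; lra.
have := KL_shift hm; have := KL_shift hp.
case: hq hp hf hm => [mq q0 q1] [mp p0 p1] [mf f0 f1] [mm m0 m1].
set A := (fun x : T => (_ * lne (_ / (p x)%:E) + _)%E).
set B := (fun x : T => (_ * lne (_ / (m x)%:E) + _)%E).
move=> AE BE.
have mA : measurable_fun setT A.
  by apply: emeasurable_funD; [exact: measurable_kl_integrand|exact/measurable_EFinP].
have mB : measurable_fun setT B.
  by apply: emeasurable_funD; [exact: measurable_kl_integrand|exact/measurable_EFinP].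
have A0 x : (0 <= A x)%E.
  by have := leeD2r (p x)%:E (kl_integrand_ge (q0 x) (p0 x)); rewrite -EFinN -EFinD addNr.
have B0 x : (0 <= B x)%E.
  by have := leeD2r (m x)%:E (kl_integrand_ge (q0 x) (m0 x)); rewrite -EFinN -EFinD addNr.
pose r x := q x * (f x / m x).
have r0 x : 0 <= r x by rewrite mulr_ge0// divr_ge0.
have mr : measurable_fun setT r.
  apply: measurable_funM => //; apply: measurable_funM => //.
  by apply: measurableT_comp => //; exact: measurable_invr.
have mEF (k : T -> R) : measurable_fun setT k -> measurable_fun setT (fun x => (k x)%:E).
  by move=> mk; exact/measurable_EFinP.
(* This integrates [kl_integrand_mix] with [p x + m x] added to both sides: [A] already contains [p]
   and [B] contains [m], so each side receives the other density. *)
have H : (\int[mu]_x (B x + ((p x)%:E + (t / (1 - t))%:E * (r x)%:E)) <=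
          \int[mu]_x (A x + ((m x)%:E + (t / (1 - t))%:E * (q x)%:E)))%E.
  apply: ge0_le_integral => //.
  - by move=> x _; rewrite adde_ge0// adde_ge0// ?mule_ge0// lee_fin// ltW.
  - apply: emeasurable_funD => //; apply: emeasurable_funD; first exact: mEF.
    by apply: measurable_funeM; exact: mEF.
  - apply: emeasurable_funD => //; apply: emeasurable_funD; first exact: mEF.
    by apply: measurable_funeM; exact: mEF.
  - move=> x _; rewrite /A /B -!EFinM.
    have := kl_integrand_mix (q0 x) (p0 x) (f0 x) t01 (mE x).
    rewrite -/(r x); set X := (_ * lne _)%E; set Y := (_ * lne _)%E => XY.
    case: X XY => [X||]; case: Y => [Y||] //=; rewrite ?leey ?leNye//.
    by rewrite -!EFinD !lee_fin; lra.
have IB : (\int[mu]_x (B x + ((p x)%:E + (t / (1 - t))%:E * (r x)%:E)) =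
    \int[mu]_x B x + (1 + (t / (1 - t))%:E * \int[mu]_x (r x)%:E))%E.
  rewrite ge0_integralD//; last 2 first.
  - by move=> x _; rewrite adde_ge0// ?mule_ge0// lee_fin// ltW.
  - by apply: emeasurable_funD; [exact: mEF|apply: measurable_funeM; exact: mEF].
  rewrite ge0_integralD// ?p1; last 4 first.
  - by move=> x _; rewrite lee_fin.
  - exact: mEF.
  - by move=> x _; rewrite mule_ge0// lee_fin// ltW.
  - by apply: measurable_funeM; exact: mEF.
  rewrite ge0_integralZl//; [exact: mEF| |by rewrite lee_fin ltW].
  by move=> x _; rewrite lee_fin.
have IA : (\int[mu]_x (A x + ((m x)%:E + (t / (1 - t))%:E * (q x)%:E)) =
    \int[mu]_x A x + (1 + (t / (1 - t))%:E))%E.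
  rewrite ge0_integralD//; last 2 first.
  - by move=> x _; rewrite adde_ge0// ?mule_ge0// lee_fin// ltW.
  - by apply: emeasurable_funD; [exact: mEF|apply: measurable_funeM; exact: mEF].
  rewrite ge0_integralD// ?m1; last 4 first.
  - by move=> x _; rewrite lee_fin.
  - exact: mEF.
  - by move=> x _; rewrite mule_ge0// lee_fin// ltW.
  - by apply: measurable_funeM; exact: mEF.
  rewrite ge0_integralZl// ?q1 ?mule1//; [exact: mEF| |by rewrite lee_fin ltW].
  by move=> x _; rewrite lee_fin.
(* Finiteness of [KL mu q p] enters here: it allows the common divergence term to be cancelled,
   after [KL mu q m] has been bounded below by [KL mu q p]. *)
have Afin : (\int[mu]_x A x)%E \is a fin_num.
  rewrite ge0_fin_numE; last exact: integral_ge0.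
  by rewrite AE lte_add_pinfty// ltry.
have : (\int[mu]_x A x + (1 + (t / (1 - t))%:E * \int[mu]_x (r x)%:E) <=
        \int[mu]_x A x + (1 + (t / (1 - t))%:E * 1))%E.
  rewrite mule1 -IA; apply: le_trans H; rewrite IB leeD2r// AE BE.
  exact: leeD2r.
by rewrite !leeD2lE// lee_pmul2l.
Qed.
End first_order_condition.

(** * Monotone limit of the mixture ratios as the weight tends to 0 *)

Lemma cvg_mixture_ratio (R : realType) (q p f : R) : 0 <= q -> 0 <= p -> 0 <= f ->
  (q * (f / (p + n.+1%:R^-1 * f)))%:E @[n --> \oo] -->
  (q%:E * (f%:E / p%:E))%E.
Proof.
move=> q0 p0 f0.
have [f00|fn] := eqVneq f 0.
  rewrite f00 mul0e mule0 (_ : (fun n => _) = cst 0%E); first exact: cvg_cst.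
  by apply/funext => n; rewrite mul0r mulr0.
have [pE|pn] := eqVneq p 0; last first.
  rewrite inver (negbTE pn) -!EFinM; apply: cvg_EFin; first exact: nearW.
  apply: cvgM; first exact: cvg_cst.
  apply: cvgM; first exact: cvg_cst.
  apply: cvgV => //.
  rewrite -[X in _ --> X]addr0 -(mul0r f).
  apply: cvgD; first exact: cvg_cst.
  by apply: cvgM; [exact: cvg_harmonic|exact: cvg_cst].
have fp : 0 < f by rewrite lt_neqAle eq_sym fn.
have [qE|qn] := eqVneq q 0.
  rewrite qE mul0e (_ : (fun n => _) = cst 0%E); first exact: cvg_cst.
  by apply/funext => n; rewrite mul0r.
have qp : 0 < q by rewrite lt_neqAle eq_sym qn.
(* With [p = 0 < f], the factor [f] cancels and the sequence is [q * n.+1], whose limit agrees with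
   the convention [f / 0 = +oo]. *)
rewrite pE inve0 gt0_muley ?lte_fin// gt0_muley ?lte_fin//.
rewrite (_ : (fun n => _) = (fun n => (q * n.+1%:R)%:E)); last first.
  apply/funext => n; congr EFin.
  by rewrite add0r; field; rewrite fn andbT nat1r pnatr_eq0.
apply/cvgeryP; apply/cvgryPge => A; near=> n.
rewrite -ler_pdivrMl// mulrC (@le_trans _ _ n%:R)//; last by rewrite ler_nat.
by near: n; exact: nbhs_infty_ger.
Unshelve. all: by end_near.
Qed.

Lemma mixture_ratio_nondecreasing (R : realType) (q p f : R) :
    0 <= q -> 0 <= p -> 0 <= f ->
  {homo (fun n : nat => (q * (f / (p + n.+1%:R^-1 * f)))%:E) :
    n m / (n <= m)%N >-> (n <= m)%E}.
Proof.
move=> q0 p0 f0 n m nm; rewrite lee_fin ler_wpM2l//.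
have [->|fn] := eqVneq f 0; first by rewrite !mul0r.
have fp : 0 < f by rewrite lt_neqAle eq_sym fn.
have k0 (k : nat) : 0 < p + k.+1%:R^-1 * f by rewrite ltr_wpDl ?mulr_gt0.
by rewrite ler_pM2l// lef_pV2 ?posrE// lerD2l ler_pM2r// lef_pV2 ?posrE// ler_nat.
Qed.

(** * The minimizer as a log-likelihood projection *)

Section projection.
Context (R : realType) (d : measure_display) (T : measurableType d).
Variables (mu : {measure set T -> \bar R}) (Theta : Type) (p : Theta -> T -> R).
Variables (q ps : T -> R).
Hypotheses (hp : forall theta, is_density mu (p theta)) (hq : is_density mu q).
Hypotheses (hconv : @convex_set R (T -> R^o) (range p)) (hps : range p ps).
Hypothesis hmin :
  KL mu q ps = ereal_inf (range (fun theta => KL mu q (p theta))).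
Hypothesis hfin : (KL mu q ps < +oo)%E.

Lemma mixture_in_model (f : T -> R) (t : R) : range p f -> 0 <= t <= 1 ->
  exists theta, forall x, p theta x = (1 - t) * ps x + t * f x.
Proof.
move=> hf /andP[t0 t1].
have := hconv (Itv01 t0 t1) (mem_set hf) (mem_set hps).
rewrite inE => -[th _ E]; exists th => x; by rewrite E addrC.
Qed.

Lemma likelihood_ratio_le1 (theta : Theta) :
  (\int[mu]_x ((q x)%:E * ((p theta x)%:E / (ps x)%:E)) <= 1)%E.
Proof.
have hdps : is_density mu ps by case: hps => th _ <-.
case: (hq) (hdps) (hp theta) => [mq q0 _] [mps ps0 _] [mf f0 _].
set f := p theta.
(* This is (1 - t) q f / m for t = 1 / (n + 2), which, unlike q f / m itself, is
   monotone in t. *)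
pose g n x := (q x * (f x / (ps x + n.+1%:R^-1 * f x)))%:E.
have mg n : measurable_fun setT (g n).
  apply/measurable_EFinP; apply: measurable_funM => //; apply: measurable_funM => //.
  apply: (measurableT_comp (@measurable_invr R)).
  by apply: measurable_funD => //; apply: measurable_funM.
have g0 n x : (0 <= g n x)%E.
  by rewrite lee_fin mulr_ge0// divr_ge0// addr_ge0// mulr_ge0.
have ndg x : {homo g^~ x : n m / (n <= m)%N >-> (n <= m)%E}.
  exact: mixture_ratio_nondecreasing.
have -> : (\int[mu]_x ((q x)%:E * ((f x)%:E / (ps x)%:E)) =
           \int[mu]_x limn (g^~ x))%E.
  apply: eq_integral => x _; apply/esym/cvg_lim => //.
  exact: cvg_mixture_ratio.
rewrite monotone_convergence//; apply: lime_le.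
  apply/cvg_ex; eexists; exact: (cvg_monotone_convergence measurableT).
apply: nearW => n.
pose t : R := n.+2%:R^-1.
have t01 : 0 < t < 1 by rewrite invr_gt0 ltr0n/= invf_lt1 ?ltr0n// ltr1n.
have /andP[t0 t1] := t01.
have [th thE] : exists th, forall x, p th x = (1 - t) * ps x + t * f x.
  by apply: mixture_in_model; [exists theta|rewrite !ltW].
have := mixture_ratio_le1 hq hdps (hp theta) t01 thE (hp th) hfin.
(* By convexity the mixture is the model density [p th], so the infimum attained at [ps] is at most
   its divergence. *)
rewrite {1}hmin => /(_ (ereal_inf_lbound _)) H.
apply: le_trans (H _); last by exists th.
have H0 x : 0 <= p th x by case: (hp th) => _ ->.
have mth : measurable_fun setT (p th) by case: (hp th).
apply: ge0_le_integral => //.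
  apply/measurable_EFinP; apply: measurable_funM => //; apply: measurable_funM => //.
  exact: (measurableT_comp (@measurable_invr R)).
move=> x _; rewrite -/f lee_fin ler_wpM2l//.
have [->|fn] := eqVneq (f x) 0; first by rewrite !mul0r.
have fp : 0 < f x by rewrite lt_neqAle eq_sym fn f0.
have pp : 0 < ps x + n.+1%:R^-1 * f x by rewrite ltr_wpDl ?mulr_gt0.
(* The weight [1 / (n + 2)] was chosen to make [t / (1 - t) = 1 / (n + 1)]. The factor [1 - t <= 1]
   then only helps the bound. *)
have E : p th x = (1 - t) * (ps x + n.+1%:R^-1 * f x).
  rewrite thE mulrDr; congr (_ + _); rewrite mulrA; congr (_ * _).
  have : 0 < n.+1%:R :> R by [].
  rewrite /t -[n.+2]addn1 natrD; set N := n.+1%:R => N0; field.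
  by rewrite !gt_eqF// addr_gt0.
rewrite ler_pM2l// lef_pV2 ?posrE//; last by rewrite E mulr_gt0// subr_gt0.
by rewrite E ler_piMl// ltW// gtrBl.
Qed.

End projection.

(** * Integration against a law with density [q] *)

Section density.
Import HBNNSimple.

(** The hypothesis on [nu] is the identity for indicators; it passes to simple functions by
    linearity and to nonnegative [h] by monotone convergence of simple approximations. *)
Lemma ge0_integral_density (R : realType) (d : measure_display)
    (T : measurableType d) (mu nu : {measure set T -> \bar R}) (q : T -> R)
    (h : T -> \bar R) :
    measurable_fun setT q -> (forall x, 0 <= q x) ->
    (forall B, measurable B -> nu B = (\int[mu]_(x in B) (q x)%:E)%E) ->
    measurable_fun setT h -> (forall x, 0 <= h x)%E ->
  (\int[nu]_x h x = \int[mu]_x ((q x)%:E * h x))%E.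
Proof.
move=> mq q0 nuE mh h0.
have mqE : measurable_fun setT (fun x => (q x)%:E) by exact/measurable_EFinP.
pose f_ := nnsfun_approx measurableT mh.
have f_cvg x : (f_ n x)%:E @[n --> \oo] --> h x.
  exact: (cvg_nnsfun_approx measurableT mh (fun x _ => h0 x)).
have f_nd x : {homo (fun n => (f_ n x)%:E) : n m / (n <= m)%N >-> (n <= m)%E}.
  by move=> n m nm; rewrite lee_fin; exact/lefP/nd_nnsfun_approx.
have mf n : measurable_fun setT (fun x => (f_ n x)%:E).
  exact/measurable_EFinP/measurable_funP.
transitivity (limn (fun n => \int[nu]_x (f_ n x)%:E)%E).
  rewrite -monotone_convergence//.
  - by apply: eq_integral => x _; apply/esym/cvg_lim => //; exact: f_cvg.
  - by move=> n x _; rewrite lee_fin.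
transitivity (limn (fun n => \int[mu]_x ((q x)%:E * (f_ n x)%:E))%E); last first.
  rewrite -monotone_convergence//.
  - apply: eq_integral => x _; apply/cvg_lim => //.
    by apply: cvgeZl => //; exact: f_cvg.
  - by move=> n; exact: emeasurable_funM.
  - by move=> n x _; rewrite mule_ge0 ?lee_fin.
  - by move=> x _ n m nm; rewrite lee_wpmul2l ?lee_fin//; exact: f_nd.
congr (limn _); apply/funext => n.
transitivity (\sum_(k \in range (f_ n))
    \int[nu]_x (k * \1_(f_ n @^-1` [set k]) x)%:E)%E.
  under eq_integral do rewrite fimfunE -fsumEFin//.
  rewrite ge0_integral_fsum//.
  - by move=> y; exact/measurable_EFinP/measurable_funM.
  - by move=> y x _; rewrite nnfun_muleindic_ge0.
transitivity (\sum_(k \in range (f_ n))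
    \int[mu]_x ((q x)%:E * (k * \1_(f_ n @^-1` [set k]) x)%:E))%E; last first.
  rewrite -ge0_integral_fsum//.
  - apply: eq_integral => x _; rewrite [in RHS]fimfunE -fsumEFin//.
    rewrite ge0_mule_fsumr// => k; exact: nnfun_muleindic_ge0.
  - move=> k; apply: emeasurable_funM => //.
    by apply/measurable_EFinP/measurable_funM.
  - by move=> k x _; rewrite mule_ge0 ?lee_fin//; exact: nnfun_muleindic_ge0.
apply: eq_fsbigr => k; rewrite inE => -[y _ <-{k}].
rewrite integralZl_indic_nnsfun// integral_indic// setIT nuE//.
rewrite integral_mkcond -ge0_integralZl//; last 3 first.
- by apply/(measurable_restrictT _ _).1 => //; exact: measurable_funTS.
- by move=> x _; rewrite patchE; case: ifPn => // _; rewrite lee_fin.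
- by rewrite lee_fin.
apply: eq_integral => x _; rewrite patchE indicE EFinM.
by case: ifPn => _; rewrite ?mule1 ?mule0 ?mulr1n ?mulr0n// muleC.
Qed.

End density.

(** * Independence of one observation from all the others *)

Section independence.
Context (R : realType) (dO dT : measure_display).
Context (Omega : measurableType dO) (T : measurableType dT).
Variables (P : probability Omega R) (N : nat) (Y : 'I_N -> {RV P >-> T}).
Hypothesis indep : mutually_independent Y.

(* [others i] is Omega with the sigma-algebra generated by the Y j, j != i. *)
Definition other_cylinders (i : 'I_N) : set (set Omega) :=
  [set A | exists B : 'I_N -> set T, [/\ forall j, measurable (B j),
     B i = setT & A = [set w | forall j, B j (Y j w)]]].

Definition others (i : 'I_N) := g_sigma_algebraType (other_cylinders i).

Lemma measurable_other_cylinders i A : other_cylinders i A -> measurable A.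
Proof.
move=> [B [mB _ ->]].
rewrite (_ : [set w | _] = \bigcap_(j in [set: 'I_N]) (Y j @^-1` B j)).
  apply: fin_bigcap_measurable => // j _.
  by rewrite -[X in measurable X]setTI; exact: measurable_funPT.
by apply/seteqP; split=> w /= H j; [move=> _|]; exact: H.
Qed.

Lemma setI_closed_other_cylinders i : setI_closed (other_cylinders i).
Proof.
move=> _ _ [B [mB Bi ->]] [C [mC Ci ->]].
exists (fun j => B j `&` C j); split.
- by move=> j; exact: measurableI.
- by rewrite Bi Ci setIT.
- by apply/seteqP; split=> [w [H1 H2] j|w H]; split=> // j; have [] := H j.
Qed.

Lemma measurable_to_others i :
  measurable_fun [set: Omega] (fun w : Omega => w : others i).
Proof.
apply: (@measurability _ _ _ (others i) _ _ (other_cylinders i)) => //.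
by move=> _ [A cA <-]; rewrite setTI; exact: (measurable_other_cylinders cA).
Qed.

Lemma measurable_others i j : j != i ->
  measurable_fun [set: others i] (fun w : others i => Y j w).
Proof.
move=> ji _ B mB; rewrite setTI; apply: sub_sigma_algebra.
exists (fun k => if k == j then B else setT); split.
- by move=> k; case: ifP.
- by rewrite eq_sym (negbTE ji).
- apply/seteqP; split=> [w H k|w /(_ j)]; last by rewrite eqxx.
  by case: eqP => [->|].
Qed.

(** For fixed [B], both sides are finite measures in [A]. They agree on the cylinders, which are
    closed under intersection and generate the sigma-algebra, hence everywhere on it. *)
Lemma indep_others i (A : set (others i)) (B : set T) : measurable A ->
  measurable B -> P (A `&` Y i @^-1` B) = (P A * P (Y i @^-1` B))%E.
Proof.
move=> mA mB.
have mYB : measurable (Y i @^-1` B).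
  by rewrite -[X in measurable X]setTI; exact: measurable_funPT.
have Pfin : P (Y i @^-1` B) \is a fin_num by exact: fin_num_measure.
pose r := NngNum (fine_ge0 (measure_ge0 P (Y i @^-1` B))).
have rE : (r%:num)%:E = P (Y i @^-1` B) by exact: fineK.
have -> : P (A `&` Y i @^-1` B) = mrestr P mYB A by [].
have -> : (P A * P (Y i @^-1` B))%E = mscale r P A.
  by rewrite muleC -rE.
apply: (g_sigma_algebra_measure_unique (other_cylinders i) _ (fun=> setT)) => //.
- exact: measurable_other_cylinders.
- move=> _; exists (fun=> setT); split=> //.
  by apply/seteqP; split.
- by apply/seteqP; split=> // w _; exists 0%N.
- exact: setI_closed_other_cylinders.
- move=> _ [C [mC Ci ->]].
  transitivity (P (Y i @^-1` B) * P [set w | forall j, C j (Y j w)])%E; last first.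
    by rewrite -rE.
  (* The cylinder [C] leaves slot [i] free, so [B] can be placed there and the intersection becomes
     a single product event. *)
  pose D j := if j == i then B else C j.
  transitivity (P [set w | forall j, D j (Y j w)]).
    congr (P _); apply/seteqP; split=> [w [H1 H2] j|w H].
      by rewrite /D; case: eqP => [->|].
    split=> [j|]; last by have := H i; rewrite /D eqxx.
    have := H j; rewrite /D; case: eqP => [->|//].
    by rewrite Ci.
  rewrite !indep//; last by move=> j; rewrite /D; case: ifP.
  rewrite (bigD1 i)//= [in RHS](bigD1 i)//= /D eqxx Ci preimage_setT.
  rewrite probability_setT mul1e; congr (_ * _)%E.
  by apply: eq_bigr => j /negbTE ->.
- move=> _; apply: (@le_lt_trans _ _ 1%E); last exact: ltry.
  by apply: probability_le1; exact: measurableI.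
Qed.

(** By [indep_others], the joint law of the identity into [others i] and of [Y i] is the product of
    their laws; Tonelli's theorem then gives the iterated integral. *)
Lemma expectation_indep (i : 'I_N) (h : others i * T -> \bar R) :
    measurable_fun setT h -> (forall z, 0 <= h z)%E ->
  (\int[P]_w h (w, Y i w) =
   \int[P]_w \int[distribution P (Y i)]_x h (w, x))%E.
Proof.
move=> mh h0.
pose idm := isMeasurableFun.Build _ _ Omega (others i) _ (@measurable_to_others i).
pose idf : {mfun Omega >-> others i} := HB.pack (fun w : Omega => w : others i) idm.
have mj : measurable_fun [set: Omega] (fun w : Omega => (w : others i, Y i w)).
  by apply: measurable_fun_pair => //; exact: measurable_to_others.
pose jm := isMeasurableFun.Build _ _ Omega (others i * T)%type _ mj.
pose jf : {mfun Omega >-> (others i * T)%type} :=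
  HB.pack (fun w : Omega => (w : others i, Y i w)) jm.
transitivity (\int[distribution P jf]_z h z)%E.
  by rewrite ge0_integral_pushforward.
transitivity (\int[distribution P idf \x distribution P (Y i)]_z h z)%E.
  apply: eq_measure_integral => /= A mA _; apply/esym.
  apply: product_measure_unique => // C D mC mD /=.
  exact: indep_others.
rewrite fubini_tonelli1// ge0_integral_pushforward//.
- exact: measurable_fun_fubini_tonelli_F.
- by move=> w _; exact: integral_ge0.
Qed.

(** Here [Z] stands for the sample from which the estimator is built. Measurability with respect to
    every [others i] says that [Z] does not involve the observations in the product, so these can be
    integrated out one at a time with [Z] held fixed, by induction on [s]. *)
Lemma expectation_prod_le1 (d : measure_display) (U : measurableType d)
    (Z : Omega -> U) (r : U -> T -> \bar R) (s : seq 'I_N) :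
    uniq s ->
    (forall i, i \in s -> measurable_fun [set: others i] (Z : others i -> U)) ->
    measurable_fun [set: U * T] (fun z => r z.1 z.2) ->
    (forall u x, 0 <= r u x)%E ->
    (forall u i, i \in s -> \int[distribution P (Y i)]_x r u x <= 1)%E ->
  (\int[P]_w (\prod_(i <- s) r (Z w) (Y i w)) <= 1)%E.
Proof.
move=> + + mr r0; elim: s => [|i s IH] /= => [_ _ _|/andP[si us] mZ r1].
  under eq_integral do rewrite big_nil.
  by rewrite integral_cst// mul1e probability_le1.
have mZi : measurable_fun [set: others i] (Z : others i -> U).
  by apply: mZ; rewrite mem_head.
(* Integrate out Y i, which is independent of Z and of the remaining Y j. *)
pose G (w : others i) : \bar R := (\prod_(j <- s) r (Z w) (Y j w))%E.
have G0 w : (0 <= G w)%E by apply: prode_ge0.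
have mrZ j : j \in s -> measurable_fun [set: others i] (fun w : others i => r (Z w) (Y j w)).
  move=> js; have ji : j != i by apply: contraNneq si => <-.
  exact: (measurableT_comp mr (measurable_fun_pair mZi (measurable_others ji))).
have mG : measurable_fun [set: others i] G.
  rewrite /G; elim: (s) mrZ => [|j s' IH'] mrZ.
    by under eq_fun do rewrite big_nil; exact: measurable_cst.
  under eq_fun do rewrite big_cons; apply: emeasurable_funM.
    by apply: mrZ; rewrite mem_head.
  by apply: IH' => k ks; apply: mrZ; rewrite inE ks orbT.
pose h (z : others i * T) : \bar R := (G z.1 * r (Z z.1) z.2)%E.
have mh : measurable_fun setT h.
  apply: emeasurable_funM; first exact: measurableT_comp.
  exact: (measurableT_comp mr (measurable_fun_pair
    (measurableT_comp mZi measurable_fst) measurable_snd)).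
have -> : (\int[P]_w (\prod_(j <- i :: s) r (Z w) (Y j w)) =
           \int[P]_w h (w, Y i w))%E.
  by apply: eq_integral => w _; rewrite big_cons muleC.
rewrite expectation_indep//; last by move=> z; rewrite mule_ge0.
have mZO : measurable_fun [set: Omega] Z.
  exact: (measurableT_comp mZi (@measurable_to_others i)).
have mGO : measurable_fun [set: Omega] (G : Omega -> \bar R).
  exact: (measurableT_comp mG (@measurable_to_others i)).
have rE w : (\int[distribution P (Y i)]_x h (w, x) =
             G w * \int[distribution P (Y i)]_x r (Z w) x)%E.
  rewrite -ge0_integralZl//.
  exact: (measurableT_comp mr (pair1_measurable (Z w))).
apply: (@le_trans _ _ (\int[P]_w G w)%E); last first.
  apply: IH => // j js; first by apply: mZ; rewrite inE js orbT.
  by move=> k; apply: r1; rewrite inE k orbT.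
apply: ge0_le_integral => //.
- by move=> w _; rewrite rE mule_ge0// integral_ge0.
- have mF := measurable_fun_fubini_tonelli_F (m2 := distribution P (Y i)) h mh.
  apply: (measurableT_comp (mF _) (@measurable_to_others i)).
  by move=> z; rewrite mule_ge0.
- move=> w _; rewrite rE -[leRHS]mule1 lee_wpmul2l//.
  by apply: r1; rewrite mem_head.
Qed.

End independence.

(** * Markov's inequality at level [1 / alpha] *)

Lemma markov_le_inv (R : realType) (d : measure_display) (Omega : measurableType d)
    (P : probability Omega R) (X : Omega -> \bar R) (alpha : R) :
    0 < alpha -> measurable_fun setT X -> (forall w, 0 <= X w)%E ->
    (\int[P]_w X w <= 1)%E ->
  ((1 - alpha)%:E <= P [set w | (X w <= (1 / alpha)%:E)%E])%E.
Proof.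
move=> a0 mX X0 X1; rewrite div1r.
have mA : measurable [set w | (X w <= alpha^-1%:E)%E].
  by rewrite -[X in measurable X]setTI; exact: emeasurable_fun_infty_c.
have mB : measurable [set w | (alpha^-1%:E <= X w)%E].
  by rewrite -[X in measurable X]setTI; exact: emeasurable_fun_c_infty.
have ai0 : 0 < alpha^-1 by rewrite invr_gt0.
have M : (P [set w | (alpha^-1%:E <= X w)%E] <= alpha%:E)%E.
  have := @le_integral_comp_abse _ _ _ P setT measurableT X alpha^-1 idfun
    (@measurable_id _ _ _) (fun r => id) (fun x y _ _ => id) mX ai0.
  rewrite setTI /=; under eq_set do rewrite gee0_abs//.
  under eq_integral do rewrite gee0_abs//.
  move=> /le_trans /(_ X1) M.
  rewrite -[leLHS]mul1e -(divff (lt0r_neq0 a0)) EFinM -muleA.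
  by rewrite -[leRHS]mule1 lee_wpmul2l// lee_fin ltW.
(* The complement is the strict event, contained in the non-strict one that Markov's inequality
   bounds. *)
have C : (P (~` [set w | (X w <= alpha^-1%:E)%E]) <= alpha%:E)%E.
  apply: le_trans M; apply: le_measure; rewrite ?inE//; first exact: measurableC.
  by move=> w /= /negP; rewrite -ltNge => /ltW.
have Pfin := fin_num_measure P _ mA.
move: C; rewrite probability_setC// EFinB leeBlDr// => C.
by rewrite leeBlDr// addeC.
Qed.

(** * The split data and the reduction to a fixed split *)

Section universal_inference.
Context (R : realType) (dO dT : measure_display).
Context (Omega : measurableType dO) (T : measurableType dT).
Variables (P : probability Omega R) (n : nat) (Y : 'I_(2 * n) -> {RV P >-> T}).

Lemma measurable_data_tuple : measurable_fun setT (data_tuple Y).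
Proof.
apply/measurable_fun_tnthP => i.
rewrite (_ : _ \o _ = Y i) ?measurable_funPT//.
by apply/funext => w /=; rewrite tnth_mktuple.
Qed.

Lemma measurable_D1_data (s : data_split n) :
  measurable_fun setT (fun y : (2 * n).-tuple T => D1_data s y).
Proof.
apply/measurable_fun_tnthP => j.
rewrite (_ : _ \o _ = fun y => tnth y (enum_val (cast_ord (esym (card_D1 s)) j))).
  exact: measurable_tnth.
by apply/funext => y /=; rewrite tnth_mktuple.
Qed.

(** All indices listed in D_1 lie in the complement of [sval s], so none equals [i]. This qualifies
    the D_1 sample as the [Z] of [expectation_prod_le1]. *)
Lemma measurable_D1_others (s : data_split n) i : i \in sval s ->
  measurable_fun [set: others Y i] (fun w : others Y i => D1_data s (data_tuple Y w)).
Proof.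
move=> si; apply/measurable_fun_tnthP => j.
pose k := enum_val (cast_ord (esym (card_D1 s)) j).
rewrite (_ : _ \o _ = fun w : others Y i => Y k w).
  apply: measurable_others.
  have : k \in ~: sval s by exact: enum_valP.
  by rewrite finset.in_setC; apply: contraNneq => ->.
by apply/funext => y /=; rewrite !tnth_mktuple.
Qed.

(** Decompose over the finitely many values of [S]: by independence of split and data, the
    probability is an average of the fixed-split probabilities with weights [P (S = s)] summing to
    1. *)
Lemma random_split_ge (S : Omega -> data_split n)
    (E : data_split n -> set ((2 * n).-tuple T)) (c : R) : 0 <= c ->
    random_split Y S -> (forall s, measurable (E s)) ->
    (forall s, c%:E <= P (data_tuple Y @^-1` E s))%E ->
  (c%:E <= P [set w | E (S w) (data_tuple Y w)])%E.
Proof.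
move=> c0 [mS indS] mE cE.
have mYE s : measurable (data_tuple Y @^-1` E s).
  by rewrite -[X in measurable X]setTI; exact: measurable_data_tuple.
have -> : [set w | E (S w) (data_tuple Y w)] =
    \bigcup_(s in [set: data_split n]) (S @^-1` [set s] `&` data_tuple Y @^-1` E s).
  by apply/seteqP; split=> [w H|w [s _ [/= -> //]]]; exists (S w).
have fin : finite_set [set: data_split n] by exact: finite_finset.
rewrite measure_fin_bigcup//; last 2 first.
- by move=> s1 s2 _ _ [w [[/= <- _] [/= <- _]]].
- by move=> s _; exact: measurableI.
apply: (@le_trans _ _ (\sum_(s \in [set: data_split n]) P (S @^-1` [set s]) * c%:E)%E).
  rewrite -ge0_mule_fsuml//.
  have -> : (\sum_(s \in [set: data_split n]) P (S @^-1` [set s]) = 1)%E.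
    rewrite -measure_fin_bigcup//; last by move=> s1 s2 _ _ [w [/= <- <-]].
    rewrite -(probability_setT P); congr (P _).
    by apply/seteqP; split=> // w _; exists (S w).
  by rewrite mul1e.
apply: lee_fsum => // s _.
by rewrite [leRHS](indS s _ (mE s)) lee_wpmul2l.
Qed.

End universal_inference.

(** * Coverage of the projection by the universal set *)

Unset Implicit Arguments.

Theorem proposition7 (R : realType) (dO dT : measure_display)
    (Omega : measurableType dO) (T : measurableType dT)
    (mu : {measure set T -> \bar R}) (Theta : Type) (p : Theta -> T -> R)
    (alpha : R) (q : T -> R) (P : probability Omega R) (n : nat)
    (Y : 'I_(2 * n) -> {RV P >-> T}) (S : Omega -> data_split n)
    (thetahat : n.-tuple T -> Theta) (pstar : T -> R)
    (halpha : 0 < alpha < 1)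
    (hp : forall theta, is_density mu (p theta))
    (hq : is_density mu q)
    (hqp : ~ range p q)
    (hY : iid_from_density mu q Y)
    (hS : random_split Y S)
    (hhat : measurable_estimator p thetahat)
    (hconv : @convex_set R (T -> R^o) (range p))
    (hpstar : range p pstar)
    (hmin : KL mu q pstar = ereal_inf (range (fun theta => KL mu q (p theta))))
    (hfin : (KL mu q pstar < +oo)%E) :
  ((1 - alpha)%:E <=
   P [set w | universal_set p alpha thetahat (S w) (data_tuple Y w) pstar])%E.
Proof.
have /andP[a0 a1] := halpha.
pose r (z : n.-tuple T) x := ((p (thetahat z) x)%:E / (pstar x)%:E)%E.
have [mps ps0 _] : is_density mu pstar by case: hpstar => th _ <-.
have [mq q0 _] := hq.
have mr : measurable_fun [set: n.-tuple T * T] (fun z => r z.1 z.2).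
  by apply: measurable_ediv => //; exact: measurableT_comp.
have r0 z x : (0 <= r z x)%E.
  by rewrite mule_ge0 ?inve_ge0 ?lee_fin//; case: (hp (thetahat z)).
have [hind hlaw] := hY.
(* For a fixed value [z] of the D_1 sample, the estimate is one fixed member of the model, so the
   projection bound applies under the law of [Y i]. *)
have r1 z i : (\int[distribution P (Y i)]_x r z x <= 1)%E.
  rewrite (ge0_integral_density mq q0 (hlaw i))//.
    exact: (likelihood_ratio_le1 hp hq hconv hpstar hmin hfin).
  exact: (measurableT_comp mr (pair1_measurable z)).
pose L (s : data_split n) (y : (2 * n).-tuple T) :=
  (\prod_(i in sval s) r (D1_data s y) (tnth y i))%E.
have mL s : measurable_fun setT (L s).
  rewrite /L; under eq_fun do rewrite -big_enum.
  elim: (enum _) => [|i l IH].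
    by under eq_fun do rewrite big_nil; exact: measurable_cst.
  under eq_fun do rewrite big_cons; apply: emeasurable_funM => //.
  exact: (measurableT_comp mr (measurable_fun_pair (measurable_D1_data s)
    (measurable_tnth i))).
have -> : [set w | universal_set p alpha thetahat (S w) (data_tuple Y w) pstar] =
    [set w | (L (S w) (data_tuple Y w) <= (1 / alpha)%:E)%E].
  by apply/seteqP; split=> w /=; [case|split].
apply: (@random_split_ge _ _ _ _ _ _ _ Y S
  (fun s => [set y | (L s y <= (1 / alpha)%:E)%E])) => //.
- by rewrite subr_ge0 ltW.
- by move=> s; rewrite -[X in measurable X]setTI; exact: emeasurable_fun_infty_c.
move=> s; apply: (@markov_le_inv _ _ _ P (L s \o data_tuple Y)) => //.
- by apply: measurableT_comp => //; exact: measurable_data_tuple.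
- by move=> w; exact: prode_ge0.
under eq_integral => w _.
  rewrite /= /L -big_enum/=.
  under eq_bigr do rewrite tnth_mktuple.
  over.
(* The factors are those of D_0, listed without repetition, and [Z] is the D_1 sample for the same
   fixed split [s]. *)
apply: (expectation_prod_le1 hind (Z := fun w => D1_data s (data_tuple Y w))) => //.
- exact: enum_uniq.
- by move=> i; rewrite mem_enum; exact: measurable_D1_others.
Qed.
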